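(* Let $B_J\in\mathbb R^{n\times n}$ satisfy $B_J\ge O$ elementwise and $\rho(B_J)>0$. Let $\mathcal B=(B_1,\dots,B_d)$ and $\mathcal B'=(B'_1,\dots,B'_{d+1})$ be splittings of $B_J$ of orders $d\ge1$ and $d+1$ (for $d=1$, $\mathcal B=(B_J)$), and suppose there exist integers $0\le r\le d-1$, $0\le s\le d$ such that, with $(C_1,\dots,C_d)=\mathcal S^r(\mathcal B)$ and $(C'_1,\dots,C'_{d+1})=\mathcal S^s(\mathcal B')$, (I) $C'_p=C_p$ for $p=1,\dots,d-1$ and (II) $(C'_d,C'_{d+1})$ is a splitting of $C_d$ (no assumption on $C'_{d+1}C'_d$). Then: (b1) if $\rho(B_J)<1$ then $\rho(T(\mathcal B'))\le\rho(T(\mathcal B))\le\rho(B_J)$; (b2) if $\rho(B_J)=1$ then $\rho(T(\mathcal B'))=\rho(T(\mathcal B))=1$; (b3) if $\rho(B_J)>1$ then $\rho(T(\mathcal B'))\ge\rho(T(\mathcal B))\ge\rho(B_J)$.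
   Context: For $B\in\mathbb R^{n\times n}$, a splitting of $B$ of order $d\ge1$ is an ordered $d$-tuple $\mathcal B=(B_1,\dots,B_d)$ of real $n\times n$ matrices with $B_p\neq O$ for all $p$, $\sum_{p=1}^d B_p=B$, and $B_p\circ B_q=O$ (Hadamard product) for $p\ne q$. The iteration matrix of $\mathcal B$ is the $dn\times dn$ matrix $T(\mathcal B)=(I_{dn}-\mathcal L)^{-1}\mathcal U$, where $\mathcal L,\mathcal U$ are $d\times d$ block matrices with $n\times n$ blocks, $\mathcal L_{ij}=B_j$ if $i>j$ and $O$ otherwise, $\mathcal U_{ij}=B_j$ if $i\le j$ and $O$ otherwise (so $T((B_J))=B_J$). The cyclic shift is $\mathcal S(B_1,\dots,B_d)=(B_d,B_1,\dots,B_{d-1})$ and $\mathcal S^r$ is its $r$-fold iterate. $\rho$ denotes spectral radius. *)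

(* Defs.v *)
From HB Require Import structures.
From mathcomp Require Import all_boot all_order all_algebra.
From mathcomp Require Import complex.
From mathcomp Require Import all_classical reals.
Set Implicit Arguments. Unset Strict Implicit. Unset Printing Implicit Defensive.
Import Order.TTheory GRing.Theory Num.Theory.
Local Open Scope ring_scope.
Local Open Scope complex_scope.

Definition specrad (R : realType) (m : nat) (A : 'M[R]_m) : R :=
  reals.sup [set x : R | exists z : R[i],
     eigenvalue (map_mx (fun a => a%:C) A) z /\ x = Normc.normc z].

Definition hadamard (R : ringType) (m : nat) (A B : 'M[R]_m) : 'M[R]_m :=
  map2_mx *%R A B.

(* A splitting of B (of order size Bs); B_p is nth 0 Bs (p-1). *)
Definition is_splitting (R : ringType) (m : nat) (B : 'M[R]_m)
    (Bs : seq 'M[R]_m) : Prop :=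
  [/\ (0 < size Bs)%N,
      forall p, (p < size Bs)%N -> nth 0 Bs p != 0,
      \sum_(C <- Bs) C = B &
      forall p q, (p < size Bs)%N -> (q < size Bs)%N -> p != q ->
        hadamard (nth 0 Bs p) (nth 0 Bs q) = 0].

Definition blkL (R : comUnitRingType) (m : nat) (Bs : seq 'M[R]_m)
  : 'M[R]_(\sum_(i < size Bs) m) :=
  \mxblock_(i < size Bs, j < size Bs)
     (if (j < i)%N then nth 0 Bs j else (0 : 'M[R]_m)).

Definition blkU (R : comUnitRingType) (m : nat) (Bs : seq 'M[R]_m)
  : 'M[R]_(\sum_(i < size Bs) m) :=
  \mxblock_(i < size Bs, j < size Bs)
     (if (i <= j)%N then nth 0 Bs j else (0 : 'M[R]_m)).

Definition iter_mx (R : comUnitRingType) (m : nat) (Bs : seq 'M[R]_m)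
  : 'M[R]_(\sum_(i < size Bs) m) :=
  invmx (1%:M - blkL Bs) *m blkU Bs.

(* cyclic shift S(B1,...,Bd) = (Bd,B1,...,B_{d-1}); S^r = rotr r *)
Definition cshift (T : Type) (r : nat) (s : seq T) : seq T := rotr r s.

(* Main.v *)
(* An eigenvector of T(B) for lambda <> 0 is a chain x_1, ..., x_d with
   lambda x_i = lambda \sum_(j < i) B_j x_j + \sum_(j >= i) B_j x_j; such chains rotate
   to chains (x_2, ..., x_d, lambda x_1), and they increase or decrease according to whether
   lambda >= 1 or lambda <= 1.  T(B) is nonnegative, so rho(T(B)) has a nonnegative
   eigenvector and dominates every mu with T(B) x >= mu x for some nonzero x >= 0.
   Monotone chains then serve as test vectors: splitting or merging the last part of an
   eigenvector chain gives such an inequality for the other splitting, in the direction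
   fixed by the position of rho(T) with respect to 1, and comparing x_1 with the
   other x_j places rho(T) on the same side of 1 as rho(B_J). *)

Require Import Defs.
From HB Require Import structures.
From mathcomp Require Import all_boot all_order all_algebra.
From mathcomp Require Import complex.
From mathcomp Require Import all_classical reals.
From mathcomp Require Import topology normedtype derive.
From mathcomp Require Import ring lra.
Set Implicit Arguments. Unset Strict Implicit. Unset Printing Implicit Defensive.
Import Order.TTheory GRing.Theory Num.Theory.
Import numFieldNormedType.Exports.
Local Open Scope ring_scope.

(** * Perron-Frobenius theory of nonnegative matrices *)

Definition nneg (R : realType) (m n : nat) (A : 'M[R]_(m, n)) : Prop :=
  forall i j, 0 <= A i j.

(** The Collatz-Wielandt numbers of [A]: for nonnegative [A] of positive size, the largest one is
    the Perron root. *)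
Definition collatz (R : realType) (m : nat) (A : 'M[R]_m) (a : R) : Prop :=
  exists x : 'cV[R]_m, [/\ nneg x, x != 0 & nneg (A *m x - a *: x)].

Section Nonneg.
Context {R : realType}.

Lemma nneg0 m n : nneg (0 : 'M[R]_(m, n)).
Proof. by move=> i j; rewrite mxE. Qed.

Lemma nnegD m n (A B : 'M[R]_(m, n)) : nneg A -> nneg B -> nneg (A + B).
Proof. by move=> hA hB i j; rewrite mxE addr_ge0. Qed.

Lemma nnegZ m n a (A : 'M[R]_(m, n)) : 0 <= a -> nneg A -> nneg (a *: A).
Proof. by move=> ha hA i j; rewrite mxE mulr_ge0. Qed.

Lemma nnegM m n p (A : 'M[R]_(m, n)) (B : 'M[R]_(n, p)) :
  nneg A -> nneg B -> nneg (A *m B).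
Proof. by move=> hA hB i j; rewrite mxE sumr_ge0 // => k _; rewrite mulr_ge0. Qed.

Lemma nneg_sum m n (I : Type) (s : seq I) (P : pred I) (F : I -> 'M[R]_(m, n)) :
  (forall i, P i -> nneg (F i)) -> nneg (\sum_(i <- s | P i) F i).
Proof. by move=> hF; apply: big_ind => //; [exact: nneg0 | exact: nnegD]. Qed.

Lemma nneg_anti m n (A : 'M[R]_(m, n)) : nneg A -> nneg (- A) -> A = 0.
Proof.
move=> hA hNA; apply/matrixP => i j; apply/eqP; rewrite eq_le.
by have := hA i j; have := hNA i j; rewrite !mxE oppr_ge0 => -> ->.
Qed.

Lemma nneg_coord_gt0 m (x : 'cV[R]_m) : nneg x -> x != 0 ->
  exists2 i, 0 < x i ord0 & forall j, x j ord0 <= x i ord0.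
Proof.
move=> hx /cV0Pn[i0 hi0].
case: (arg_maxP (fun i => x i ord0) (erefl true : xpredT i0)) => i _ hi.
exists i; last by move=> j; exact: hi.
by rewrite (lt_le_trans _ (hi i0 isT)) // lt_neqAle eq_sym hi0 hx.
Qed.

Lemma unitmx_cV (F : fieldType) m (M : 'M[F]_m) :
  (forall x : 'cV_m, M *m x = 0 -> x = 0) -> M \in unitmx.
Proof.
move=> hM; rewrite -unitmx_tr -row_free_unit; apply/inj_row_free => v hv.
by apply/trmx_inj; rewrite trmx0; apply: hM; rewrite -[M]trmxK -trmx_mul hv trmx0.
Qed.

(* The negative part of a vector [x] with [A x <= z x] witnesses [collatz A z]
   unless it vanishes. *)
Lemma collatz_inverse_positive m (A : 'M[R]_m) (z : R) (x : 'cV[R]_m) :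
  nneg A -> ~ collatz A z -> nneg (z *: x - A *m x) -> nneg x.
Proof.
move=> hA hz hx.
pose y : 'cV[R]_m := \col_i Num.max 0 (- x i ord0).
have y0 : nneg y by move=> i j; rewrite mxE le_max lexx.
have [/eqP y_eq0|y_neq0] := boolP (y == 0).
  move=> i j; rewrite ord1; have := congr1 (fun v : 'cV[R]_m => v i ord0) y_eq0.
  by rewrite !mxE => h; rewrite -oppr_le0 -h le_max lexx orbT.
case: hz; exists y; split => // i j; rewrite ord1 !mxE.
case: (leP 0 (- x i ord0)) => [hxi|_]; last first.
  by rewrite mulr0 subr0 sumr_ge0 // => k _; rewrite mulr_ge0.
have := hx i ord0; rewrite !mxE => hi.
rewrite mulrN opprK addrC (le_trans hi) // lerD2l -sumrN ler_sum // => k _.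
by rewrite mxE -mulrN ler_wpM2l // le_max lexx orbT.
Qed.

(** Inverse positivity applies both to a kernel vector and to its opposite, so the vector
    vanishes. *)
Lemma collatz_resolvent_unit m (A : 'M[R]_m) (z : R) :
  nneg A -> ~ collatz A z -> z%:M - A \in unitmx.
Proof.
move=> hA hz; apply: unitmx_cV => x; rewrite mulmxBl mul_scalar_mx => hx.
apply: nneg_anti; apply: (collatz_inverse_positive hA hz).
  by rewrite hx; exact: nneg0.
by rewrite scalerN mulmxN -opprD hx oppr0; exact: nneg0.
Qed.

(** At the largest coordinate [x_i], the [i]-th entry of [A x] is at most [x_i] times the [i]-th row
    sum. *)
Lemma collatz_bound m (A : 'M[R]_m) (a : R) :
  nneg A -> collatz A a -> a <= \sum_i \sum_j A i j.
Proof.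
move=> hA [x [x0 /(nneg_coord_gt0 x0)[i xi_gt0 xi_max] hx]].
rewrite -(ler_pM2r xi_gt0).
have := hx i ord0; rewrite !mxE subr_ge0 => /le_trans; apply.
rewrite [in leRHS](bigD1 i) //= mulrDl -[leLHS]addr0 lerD //.
  by rewrite mulr_suml ler_sum // => k _; rewrite ler_wpM2l.
by rewrite mulr_ge0 ?(ltW xi_gt0) // sumr_ge0 // => k _; rewrite sumr_ge0.
Qed.

Lemma collatz0 m (A : 'M[R]_m) : (0 < m)%N -> nneg A -> collatz A 0.
Proof.
move=> m0 hA; exists (const_mx 1); split.
- by move=> i j; rewrite mxE.
- by apply/cV0Pn; exists (Ordinal m0); rewrite mxE oner_neq0.
- by rewrite scale0r subr0; apply: nnegM => // i j; rewrite mxE.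
Qed.

(* [v] is the normalized solution of [(z - A) y = 1], which blows up as [z] decreases to
   the supremum of [collatz A]. *)
Lemma collatz_approx_eigenvector m (A : 'M[R]_m) (z z' : R) :
  nneg A -> ~ collatz A z -> collatz A z' -> z' < z ->
  exists v : 'cV[R]_m, [/\ nneg v, \sum_i v i ord0 = 1 &
    forall i, 0 <= z * v i ord0 - (A *m v) i ord0 <= z - z'].
Proof.
move=> hA hz [x [x0 xn0 hx]] lt_z'z.
have [k xk_gt0 xk_max] := nneg_coord_gt0 x0 xn0.
pose y : 'cV[R]_m := invmx (z%:M - A) *m const_mx 1.
have yE : z *: y - A *m y = const_mx 1.
  by rewrite -mul_scalar_mx -mulmxBl mulKVmx // collatz_resolvent_unit.
have y0 : nneg y.
  by apply: (collatz_inverse_positive hA hz); rewrite yE => i j; rewrite mxE.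
(* Since [A x >= z' x], one has [(z - A) x <= (z - z') x_k 1 = (z - A) ((z - z') x_k y)]. Inverse
   positivity gives [x <= (z - z') x_k y], which is then read at coordinate [k]. *)
have yk : 1 <= (z - z') * y k ord0.
  have h : nneg (((z - z') * x k ord0) *: y - x).
    set c := (z - z') * x k ord0; apply: (collatz_inverse_positive hA hz).
    have -> : z *: (c *: y - x) - A *m (c *: y - x)
        = c *: const_mx 1 - (z *: x - A *m x).
      rewrite -yE mulmxBr -scalemxAr.
      move: (A *m y) (A *m x) => Ay Ax; apply/matrixP => i j; rewrite !mxE; ring.
    move=> i j; rewrite ord1; have := hx i ord0; have := xk_max i; rewrite !mxE /c.
    move=> ? ?; nra.
  have := h k ord0; rewrite !mxE subr_ge0 mulrAC -[leLHS]mul1r ler_pM2r //.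
have S_ge : y k ord0 <= \sum_i y i ord0.
  by rewrite (bigD1 k) //= lerDl sumr_ge0.
have zz' : 0 < z - z' by rewrite subr_gt0.
have S_gt0 : 0 < \sum_i y i ord0.
  by apply: lt_le_trans S_ge; rewrite -(pmulr_rgt0 _ zz') (lt_le_trans _ yk).
exists ((\sum_i y i ord0)^-1 *: y); split.
- by apply: nnegZ => //; rewrite invr_ge0 ltW.
- under eq_bigr do rewrite mxE.
  by rewrite -mulr_sumr mulVf // gt_eqF.
- move=> i.
  have -> : z * ((\sum_i y i ord0)^-1 *: y) i ord0
      - (A *m ((\sum_i y i ord0)^-1 *: y)) i ord0 = (\sum_i y i ord0)^-1.
    have := congr1 (fun v : 'cV[R]_m => v i ord0) yE.
    rewrite -scalemxAr !mxE mulrCA -mulrBr => ->; exact: mulr1.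
  rewrite invr_ge0 ltW //= -[leLHS]mul1r ler_pdivrMr //.
  by rewrite (le_trans yk) // ler_wpM2l // ltW.
Qed.

Lemma continuous_sum (T : topologicalType) (m : nat) (F : 'I_m -> T -> R) :
  (forall i, continuous (F i)) -> continuous (fun x => \sum_i F i x).
Proof.
move=> cF.
exact: (@continuous_big R 'I_m +%R 0 xpredT (@add_continuous R) T _ F (fun i _ => cF i)).
Qed.

Lemma perron_frobenius m (A : 'M[R]_m) : (0 < m)%N -> nneg A ->
  exists r, (exists x : 'cV[R]_m, [/\ nneg x, x != 0 & A *m x = r *: x])
    /\ (forall a, collatz A a -> a <= r).
Proof.
move=> m_gt0 hA; pose S : set R := collatz A.
have supS : has_sup S.
  by split; [exists 0; exact: collatz0 | exists (\sum_i \sum_j A i j) => a; exact: collatz_bound].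
set r := reals.sup S; exists r; split; last by move=> a; exact: sup_upper_bound.
(* [f] vanishes exactly at the normalized eigenvectors for [r], and the approximate
   eigenvectors force its minimum over the box to be [0]. *)
pose f (v : 'rV[R]_m) : R := `|1 - \sum_i v ord0 i|
  + \sum_i `|r * v ord0 i - \sum_j A i j * v ord0 j|.
pose box : set 'rV[R]_m := [set v : 'rV[R]_m | forall i, `[0, 1]%classic (v ord0 i)]%classic.
have box_compact : compact box.
  exact: (@rV_compact R m (fun=> `[0, 1]%classic) (fun=> @segment_compact R 0 1)).
have f_cont : continuous f.
  have coord i : continuous (fun v : 'rV[R]_m => v ord0 i) by exact: coord_continuous.
  have c1 : continuous (fun v : 'rV[R]_m => 1 - \sum_i v ord0 i).
    have cS : continuous (fun v : 'rV[R]_m => \sum_i v ord0 i).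
      exact: (@continuous_sum _ _ (fun i (v : 'rV[R]_m) => v ord0 i)).
    by move=> v; exact: (@cvgB _ _ _ _ _ (fun=> 1 : R) _ _ _ (cvg_cst _) (cS v)).
  have c2 i : continuous (fun v : 'rV[R]_m => r * v ord0 i - \sum_j A i j * v ord0 j).
    have cA : continuous (fun v : 'rV[R]_m => \sum_j A i j * v ord0 j).
      apply: (@continuous_sum _ _ (fun j (v : 'rV[R]_m) => A i j * v ord0 j)) => j v.
      exact: cvgMl_tmp (coord j v).
    by move=> v; exact: (@cvgB _ _ _ _ _ _ _ _ _ (cvgMl_tmp (coord i v)) (cA v)).
  have c3 : continuous (fun v : 'rV[R]_m =>
      \sum_i `|r * v ord0 i - \sum_j A i j * v ord0 j|).
    apply: (@continuous_sum _ _ (fun i (v : 'rV[R]_m) =>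
      `|r * v ord0 i - \sum_j A i j * v ord0 j|)) => i v.
    exact: cvg_norm (c2 i v).
  by move=> v; exact: (@cvgD _ _ _ _ _ _ _ _ _ (cvg_norm (c1 v)) (c3 v)).
have box0 : box 0 by move=> i; rewrite /= mxE in_itv /= lexx ler01.
have [v] := EVT_min_rV (ex_intro _ 0 box0) box_compact (continuous_subspaceT f_cont).
rewrite inE => v_box v_min.
have f_ge0 w : 0 <= f w by rewrite addr_ge0 ?sumr_ge0.
have fv0 : f v = 0.
  apply/eqP; rewrite eq_le f_ge0 andbT leNgt; apply/negP => fv_gt0.
  (* The residual of the approximate eigenvector at [z = r + e] lies in [[0, 2 e]], and passing from
     [z] to [r] shifts it by at most [e]. The factor [4] leaves a total of at most three quarters of
     [f v]. *)
  pose e := f v / (4 * m%:R).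
  have e_gt0 : 0 < e by rewrite divr_gt0 // mulr_gt0 // ltr0n.
  have [z' Sz' lt_z'] := sup_adherent e_gt0 supS.
  have nSz : ~ S (r + e).
    by move=> /(sup_upper_bound supS); rewrite -/r gerDl leNgt e_gt0.
  have lt_zz' : z' < r + e.
    by rewrite (le_lt_trans (sup_upper_bound supS Sz')) // ltrDl.
  have [w [w0 w1 hw]] := collatz_approx_eigenvector hA nSz Sz' lt_zz'.
  have w_le1 i : w i ord0 <= 1.
    by rewrite -w1 (bigD1 i) //= lerDl sumr_ge0.
  have : f v <= f w^T.
    by apply: v_min; rewrite inE => i; rewrite /= mxE in_itv /= w0 w_le1.
  have -> : f w^T = \sum_i `|r * w i ord0 - \sum_j A i j * w j ord0|.
    rewrite /f; under eq_bigr do rewrite mxE.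
    rewrite w1 subrr normr0 add0r; apply: eq_bigr => i _; rewrite mxE.
    by under eq_bigr do rewrite mxE.
  apply/negP; rewrite -ltNge.
  apply: (@le_lt_trans _ _ (\sum_(i < m) 3 * e)).
    apply: ler_sum => i _; have := hw i; rewrite mxE => /andP[h1 h2].
    have := w_le1 i; have := w0 i ord0 => ? ?; rewrite ler_norml -/r in lt_z' *.
    by apply/andP; split; nra.
  rewrite sumr_const card_ord -(mulr_natr (3 * e)) /e.
  have m0 : (0 : R) < m%:R by rewrite ltr0n.
  rewrite (_ : 3 * _ * _ = f v * (3 / 4)); last by field; rewrite gt_eqF.
  by rewrite gtr_pMr //; lra.
have [h1 h2] : `|1 - \sum_i v ord0 i| = 0
    /\ \sum_i `|r * v ord0 i - \sum_j A i j * v ord0 j| = 0.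
  by split; apply/eqP; move: fv0 => /eqP; rewrite paddr_eq0 ?sumr_ge0 // => /andP[].
exists v^T; split.
- by move=> i j; rewrite mxE ord1; have := v_box i; rewrite /= in_itv /= => /andP[].
- apply/eqP => v0; move: h1; rewrite big1 ?subr0 ?normr1 => [/eqP|i _]; first by rewrite oner_eq0.
  by have := congr1 (fun u : 'cV[R]_m => u i ord0) v0; rewrite !mxE.
- apply/colP => i; rewrite !mxE.
  move/eqP: h2; rewrite psumr_eq0 // => /allP/(_ i (mem_index_enum _)) /=.
  rewrite normr_eq0 subr_eq0 => /eqP ->; by under eq_bigr do rewrite mxE.
Qed.

End Nonneg.

(** * Spectral radius as the Perron root *)

Section SpectralRadius.
Context {R : realType}.

(** [eigenvalue] refers to row eigenvectors; column eigenvectors are reached because [A] and its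
    transpose share their characteristic polynomial. *)
Lemma eigenvalue_cV (F : fieldType) m (A : 'M[F]_m) (z : F) :
  eigenvalue A z <-> exists2 x : 'cV[F]_m, x != 0 & A *m x = z *: x.
Proof.
have char_tr : char_poly A^T = char_poly A.
  rewrite /char_poly -det_tr /char_poly_mx; congr (\det _).
  by apply/matrixP => i j; rewrite !mxE eq_sym.
rewrite eigenvalue_root_char -char_tr -eigenvalue_root_char.
split=> [/eigenvalueP[v hv v0]|[x x0 hx]].
  by exists v^T; rewrite ?trmx_eq0 // -[A]trmxK -trmx_mul hv linearZ.
by apply/eigenvalueP; exists x^T; rewrite ?trmx_eq0 // -trmx_mul hx linearZ.
Qed.

Lemma normc_real (a : R) : Normc.normc (a%:C)%C = `|a|.
Proof. by rewrite /Normc.normc /= expr0n addr0 sqrtr_sqr. Qed.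

Lemma normc_ge0 (z : R[i]%C) : 0 <= Normc.normc z.
Proof. by case: z => a b; exact: sqrtr_ge0. Qed.

Lemma normc_sum_le (I : Type) (s : seq I) (F : I -> R[i]%C) :
  Normc.normc (\sum_(i <- s) F i) <= \sum_(i <- s) Normc.normc (F i).
Proof.
apply: (big_ind2 (fun z a => Normc.normc z <= a)) => //; first by rewrite Normc.normc0.
by move=> z1 a1 z2 a2 h1 h2; rewrite (le_trans (le_normcD _ _)) // lerD.
Qed.

(** The entrywise moduli of a complex eigenvector serve as test vector: the triangle inequality
    gives [|z| |x| <= A |x|]. *)
Lemma collatz_eigenvalue m (A : 'M[R]_m) (z : R[i]%C) : nneg A ->
  eigenvalue (map_mx (fun a => (a%:C)%C) A) z -> collatz A (Normc.normc z).
Proof.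
move=> hA /eigenvalue_cV[x x0 hx].
exists (\col_i Normc.normc (x i ord0)); split.
- by move=> i j; rewrite mxE; exact: normc_ge0.
- have /cV0Pn[i xi] := x0; apply/cV0Pn; exists i; rewrite mxE.
  by apply: contra_neq xi => /Normc.eq0_normc.
- move=> i j; rewrite !mxE subr_ge0 -Normc.normcM.
  have := congr1 (fun u : 'cV_m => u i ord0) hx; rewrite !mxE => <-.
  apply: le_trans (normc_sum_le _ _) _; apply: ler_sum => k _.
  by rewrite !mxE Normc.normcM normc_real ger0_norm.
Qed.

(** The Perron root is itself an eigenvalue, and the modulus of any eigenvalue is a Collatz number,
    hence at most that root. *)
Lemma specrad_perron m (A : 'M[R]_m) : (0 < m)%N -> nneg A ->
  (exists x : 'cV[R]_m, [/\ nneg x, x != 0 & A *m x = specrad A *: x])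
  /\ (forall a, collatz A a -> a <= specrad A).
Proof.
move=> m0 hA; have [r [[x [x_ge0 x_neq0 hx]] r_max]] := perron_frobenius m0 hA.
suff -> : specrad A = r by split=> //; exists x.
have r_ge0 : 0 <= r by apply: r_max; exact: collatz0.
rewrite /specrad; set S := (X in reals.sup X).
have Sr : S r.
  exists (r%:C)%C; split; last by rewrite normc_real ger0_norm.
  apply/eigenvalue_cV; exists (map_mx (fun a => (a%:C)%C) x).
    by rewrite (map_mx_eq0 (real_complex R)).
  by rewrite -(map_mxM (real_complex R)) hx (map_mxZ (real_complex R)).
have Sub : ubound S r by move=> a [z [hz ->]]; apply: r_max; exact: collatz_eigenvalue.
apply/eqP; rewrite eq_le (ge_sup (ex_intro _ r Sr) Sub) /=.
by apply: (ub_le_sup (ex_intro _ r Sub)).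
Qed.

Lemma specrad_ge0 m (A : 'M[R]_m) : (0 < m)%N -> nneg A -> 0 <= specrad A.
Proof. by move=> m0 hA; apply: (specrad_perron m0 hA).2; exact: collatz0. Qed.

(** The spectrum is empty and the supremum of the empty set is [0] by convention; a positive
    spectral radius therefore excludes [n = 0]. *)
Lemma specrad0 (A : 'M[R]_0) : specrad A = 0.
Proof.
rewrite /specrad (_ : mkset _ = classical_sets.set0) ?sup0 //.
apply/classical_sets.seteqP; split=> // a [z [/eigenvalue_cV[x x0 _] _]].
by case/eqP: x0; apply/colP => -[].
Qed.

End SpectralRadius.

(** * Iteration matrices in block coordinates *)

(* Block row [i] of [mu L + U] applied to the block column [x_0, x_1, ...], so that
   [T x = mu x] reads [sweep mu Bs x i = mu x_i]. *)
Definition sweep (R : realType) (n : nat) (mu : R) (Bs : seq 'M[R]_n)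
    (x : nat -> 'cV[R]_n) (i : nat) : 'cV[R]_n :=
  \sum_(0 <= j < size Bs) (if (j < i)%N then mu else 1) *: (nth 0 Bs j *m x j).

Definition nneg_seq (R : realType) (n : nat) (Bs : seq 'M[R]_n) : Prop :=
  forall B, B \in Bs -> nneg B.

Section Sweep.
Context {R : realType} {n : nat}.
Implicit Types (B : 'M[R]_n) (Bs : seq 'M[R]_n) (x : nat -> 'cV[R]_n) (mu : R).

Lemma nneg_seq_nth Bs j : nneg_seq Bs -> nneg (nth 0 Bs j).
Proof.
move=> hB; have [lt_j|le_j] := ltnP j (size Bs); first exact: hB (mem_nth _ lt_j).
by rewrite nth_default //; exact: nneg0.
Qed.

(** Chains are functions on [nat], so that they can be shifted, extended and truncated without
    casts; only the first [d] blocks enter. *)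
Definition blkcol d x : 'cV[R]_(\sum_(i < d) n) := \mxcol_(i < d) x i.

Lemma nneg_blkcol d x : nneg (blkcol d x) <-> (forall i, (i < d)%N -> nneg (x i)).
Proof.
split=> [h i lt_i|h s j]; last by rewrite mxE; exact: h.
move=> a b; have <- : submxcol (blkcol d x) (Ordinal lt_i) a b = x i a b.
  by rewrite mxcolK.
by rewrite mxE; exact: h.
Qed.

Lemma blkcolP d (X : 'cV[R]_(\sum_(i < d) n)) :
  exists x, X = blkcol d x /\ forall i, (d <= i)%N -> x i = 0.
Proof.
exists (fun i => oapp (submxcol X) 0 (insub i)); split.
  by rewrite -[LHS]submxcolK; apply: eq_mxcol => i; rewrite valK.
by move=> i le_di; rewrite insubN // -leqNgt.
Qed.

Lemma blkcol_eq0 d x : blkcol d x = 0 <-> (forall i, (i < d)%N -> x i = 0).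
Proof.
have -> : 0 = blkcol d (fun=> 0) by rewrite /blkcol mxcol0.
rewrite /blkcol; split=> [/eq_mxcolP h i lt_i|h].
  exact: h (Ordinal lt_i).
by apply: eq_mxcol => i; exact: h.
Qed.

Lemma blkcolB d x y : blkcol d x - blkcol d y = blkcol d (fun i => x i - y i).
Proof. by rewrite /blkcol mxcolB. Qed.

Lemma blkcolZ d a x : a *: blkcol d x = blkcol d (fun i => a *: x i).
Proof. by apply/matrixP => i j; rewrite !mxE. Qed.

Lemma blkL_mul Bs x : blkL Bs *m blkcol (size Bs) x = blkcol (size Bs)
  (fun i => \sum_(0 <= j < size Bs) if (j < i)%N then nth 0 Bs j *m x j else 0).
Proof.
rewrite /blkL mxblockEv mxcol_mul; apply: eq_mxcol => i.
rewrite mul_mxrow_mxcol big_mkord; apply: eq_bigr => j _.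
by case: ifP; rewrite ?mul0mx.
Qed.

Lemma blkU_mul Bs x : blkU Bs *m blkcol (size Bs) x = blkcol (size Bs)
  (fun i => \sum_(0 <= j < size Bs) if (i <= j)%N then nth 0 Bs j *m x j else 0).
Proof.
rewrite /blkU mxblockEv mxcol_mul; apply: eq_mxcol => i.
rewrite mul_mxrow_mxcol big_mkord; apply: eq_bigr => j _.
by case: ifP; rewrite ?mul0mx.
Qed.

Lemma sweep_blk Bs x mu :
  blkU Bs *m blkcol (size Bs) x - mu *: ((1%:M - blkL Bs) *m blkcol (size Bs) x)
  = blkcol (size Bs) (fun i => sweep mu Bs x i - mu *: x i).
Proof.
rewrite mulmxBl mul1mx blkL_mul blkU_mul blkcolB blkcolZ blkcolB.
apply: eq_mxcol => i; rewrite scalerBr opprB addrA [in RHS]/sweep; congr (_ - _).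
rewrite scaler_sumr -big_split; apply: eq_bigr => j _ /=.
by rewrite ltnNge; case: leqP; rewrite ?scale1r ?scaler0 ?addr0 ?add0r.
Qed.

(** Forward substitution: block [i] of [L X] involves only earlier blocks, so nonnegativity
    propagates from each block to the next. *)
Lemma nneg_one_sub_blkL Bs (X : 'cV[R]_(\sum_(i < size Bs) n)) :
  nneg_seq Bs -> nneg ((1%:M - blkL Bs) *m X) -> nneg X.
Proof.
move=> hB; have [x [-> _]] := blkcolP X.
rewrite mulmxBl mul1mx blkL_mul blkcolB => /nneg_blkcol h; apply/nneg_blkcol.
move=> i; elim/ltn_ind: i => i IH lt_i; rewrite -[x i](subrK (\sum_(0 <= j < size Bs)
  if (j < i)%N then nth 0 Bs j *m x j else 0)).
apply: nnegD; first exact: h.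
apply: nneg_sum => j _; case: ifP => lt_ji; last exact: nneg0.
by apply: nnegM; [exact: nneg_seq_nth | apply: IH => //; exact: ltn_trans lt_i].
Qed.

Lemma one_sub_blkL_unit Bs : nneg_seq Bs -> 1%:M - blkL Bs \in unitmx.
Proof.
move=> hB; apply: unitmx_cV => X hX; apply: nneg_anti; apply: (nneg_one_sub_blkL hB).
  by rewrite hX; exact: nneg0.
by rewrite mulmxN hX oppr0; exact: nneg0.
Qed.

(** [I - L] sends each column of [T] to the corresponding column of [U], which is nonnegative. *)
Lemma nneg_iter_mx Bs : nneg_seq Bs -> nneg (iter_mx Bs).
Proof.
move=> hB i j.
suff /(_ i ord0) : nneg (col j (iter_mx Bs)) by rewrite mxE.
apply: (nneg_one_sub_blkL hB); rewrite /iter_mx colE -mulmxA mulKVmx ?one_sub_blkL_unit // -colE.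
move=> {i} i k; rewrite !mxE; case: ifP => _; last by rewrite mxE.
exact: nneg_seq_nth.
Qed.

(** Multiplying by [I - L] clears the inverse in [T], which turns relations between [T x] and [mu x]
    into relations on [sweep]. *)
Lemma iter_mx_subE Bs x mu : nneg_seq Bs ->
  (1%:M - blkL Bs) *m (iter_mx Bs *m blkcol (size Bs) x - mu *: blkcol (size Bs) x)
  = blkcol (size Bs) (fun i => sweep mu Bs x i - mu *: x i).
Proof.
move=> hB.
by rewrite -sweep_blk mulmxBr -scalemxAr /iter_mx -mulmxA mulKVmx ?one_sub_blkL_unit.
Qed.

Lemma blk_size_gt0 Bs : (0 < n)%N -> (0 < size Bs)%N -> (0 < \sum_(i < size Bs) n)%N.
Proof. by move=> n0 s0; rewrite sum_nat_const card_ord muln_gt0 s0. Qed.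

Lemma sweep_perron Bs : (0 < n)%N -> (0 < size Bs)%N -> nneg_seq Bs ->
  exists x, [/\ forall j, nneg (x j), exists2 i, (i < size Bs)%N & x i != 0 &
    forall i, (i < size Bs)%N ->
      sweep (specrad (iter_mx Bs)) Bs x i = specrad (iter_mx Bs) *: x i].
Proof.
move=> n0 s0 hB.
have [[X [X_ge0 X0 hX]] _] := specrad_perron (blk_size_gt0 n0 s0) (nneg_iter_mx hB).
have [x [XE x_out]] := blkcolP X; rewrite {X}XE in X_ge0 X0 hX; exists x; split.
- move=> j; have [lt_j|le_j] := ltnP j (size Bs).
    exact: (nneg_blkcol _ _).1 X_ge0 _ lt_j.
  by rewrite x_out //; exact: nneg0.
- apply: contrapT => h; case/eqP: X0; apply/blkcol_eq0 => i lt_i.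
  by apply/eqP; apply: contrapT => /negP xi; apply: h; exists i.
- have := iter_mx_subE x (specrad (iter_mx Bs)) hB.
  rewrite hX subrr mulmx0 => /esym/blkcol_eq0 h i lt_i.
  by apply/eqP; rewrite -subr_eq0 h.
Qed.

(** Inverse positivity of [I - L] lifts the blockwise inequalities to [T x >= mu x], so [mu] is a
    Collatz number of [T]. *)
Lemma sweep_le_specrad Bs x mu : (0 < n)%N -> nneg_seq Bs ->
  (forall j, (j < size Bs)%N -> nneg (x j)) ->
  (exists2 i, (i < size Bs)%N & x i != 0) ->
  (forall i, (i < size Bs)%N -> nneg (sweep mu Bs x i - mu *: x i)) ->
  mu <= specrad (iter_mx Bs).
Proof.
move=> n0 hB x_ge0 [i lt_i xi] hx.
have s0 : (0 < size Bs)%N by exact: leq_ltn_trans lt_i.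
apply: (specrad_perron (blk_size_gt0 n0 s0) (nneg_iter_mx hB)).2.
exists (blkcol (size Bs) x); split.
- exact/nneg_blkcol.
- by apply: contra_neq xi => /blkcol_eq0; apply.
- apply: (nneg_one_sub_blkL hB); rewrite iter_mx_subE //; exact/nneg_blkcol.
Qed.

Lemma sweep_rcons Bs B x mu i : sweep mu (rcons Bs B) x i
  = sweep mu Bs x i + (if (size Bs < i)%N then mu else 1) *: (B *m x (size Bs)).
Proof.
rewrite /sweep size_rcons big_nat_recr //= nth_rcons ltnn eqxx; congr (_ + _).
by apply: eq_big_nat => j /andP[_ lt_j]; rewrite nth_rcons lt_j.
Qed.

Lemma sweep_cons0 Bs B x mu :
  sweep mu (B :: Bs) x 0 = B *m x 0 + sweep mu Bs (fun j => x j.+1) 0.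
Proof. by rewrite /sweep /= big_nat_recl //= scale1r. Qed.

Lemma sweep_consS Bs B x mu i :
  sweep mu (B :: Bs) x i.+1 = mu *: (B *m x 0) + sweep mu Bs (fun j => x j.+1) i.
Proof. by rewrite /sweep /= big_nat_recl. Qed.

Lemma sweep0E Bs x mu : sweep mu Bs x 0 = \sum_(0 <= j < size Bs) nth 0 Bs j *m x j.
Proof. by apply: eq_bigr => j _; rewrite scale1r. Qed.

(** Past the last part every coefficient is [mu], while in row [0] every coefficient is [1]. Such
    rows occur when a list is extended by [rcons]. *)
Lemma sweep_full Bs x mu i : (size Bs <= i)%N -> sweep mu Bs x i = mu *: sweep mu Bs x 0.
Proof.
move=> le_i; rewrite sweep0E scaler_sumr; apply: eq_big_nat => j /andP[_ lt_j].
by rewrite (leq_trans lt_j).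
Qed.

Lemma eq_sweep Bs x y mu i : (forall j, (j < size Bs)%N -> x j = y j) ->
  sweep mu Bs x i = sweep mu Bs y i.
Proof. by move=> h; apply: eq_big_nat => j /andP[_ lt_j]; rewrite h. Qed.

End Sweep.

(** * Comparison of spectral radii *)

Section Comparison.
Context {R : realType} {n : nat} (n0 : (0 < n)%N).
Implicit Types (B C D : 'M[R]_n) (Bs : seq 'M[R]_n) (x : nat -> 'cV[R]_n).
Local Notation rhoT Bs := (specrad (iter_mx Bs)).

Lemma rhoT_ge0 Bs : (0 < size Bs)%N -> nneg_seq Bs -> 0 <= rhoT Bs.
Proof. by move=> s0 hB; apply: specrad_ge0; [exact: blk_size_gt0|exact: nneg_iter_mx]. Qed.

Lemma nneg_scaled m (v : 'cV[R]_m) a : 0 < a -> nneg (a *: v) -> nneg v.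
Proof. by move=> a0 h i j; have := h i j; rewrite mxE pmulr_rge0. Qed.

Lemma nneg_sub_eq0 m (u v : 'cV[R]_m) : nneg v -> nneg (u - v) -> u = 0 -> v = 0.
Proof. by move=> hv h u0; apply: nneg_anti => //; rewrite -[- v]add0r -u0. Qed.

Lemma sum_mulmx Bs (v : 'cV[R]_n) :
  (\sum_(B <- Bs) B) *m v = \sum_(0 <= j < size Bs) nth 0 Bs j *m v.
Proof. by rewrite (big_nth 0) mulmx_suml. Qed.

Lemma nneg_sum_seq Bs : nneg_seq Bs -> nneg (\sum_(B <- Bs) B).
Proof.
move=> hB; rewrite (big_nth 0); apply: nneg_sum => j _; exact: nneg_seq_nth.
Qed.

Lemma nneg_seq_rcons Bs B : nneg_seq (rcons Bs B) <-> nneg_seq Bs /\ nneg B.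
Proof.
split=> [h|[h hB] A]; last by rewrite mem_rcons inE => /orP[/eqP->|/h].
by split=> [A hA|]; apply: h; rewrite mem_rcons inE ?eqxx ?hA ?orbT.
Qed.

(** The coefficients of row [i] are [mu] or [1], both at most [c]. The choices [c = 1] for [mu <= 1]
    and [c = mu] for [mu >= 1] compare the first block of a chain with the others. *)
Lemma sweep_diff Bs x mu i c : nneg_seq Bs -> (forall j, nneg (x j)) ->
  (mu <= c) -> 1 <= c -> nneg (c *: sweep mu Bs x 0 - sweep mu Bs x i).
Proof.
move=> hB x0 mu_c c1; rewrite sweep0E scaler_sumr -sumrB; apply: nneg_sum => j _.
rewrite -scalerBl; apply: nnegZ; first by rewrite subr_ge0; case: ifP.
by apply: nnegM => //; exact: nneg_seq_nth.
Qed.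

Lemma sweep_size Bs x mu : sweep mu Bs x (size Bs).+1 = sweep mu Bs x (size Bs).
Proof. by rewrite (sweep_full _ _ (leqnSn _)) (sweep_full _ _ (leqnn _)). Qed.

(** * Invariance under cyclic shifts *)

Lemma rhoT_rot1 Bs : nneg_seq Bs -> rhoT Bs <= rhoT (rot 1 Bs).
Proof.
case: Bs => [|B Bs] // hB.
have hB' : nneg_seq (rcons Bs B).
  by move=> A; rewrite mem_rcons; exact: hB.
rewrite rot1_cons; have [le0|gt0] := leP (rhoT (B :: Bs)) 0.
  by apply: le_trans le0 _; apply: rhoT_ge0 => //; rewrite size_rcons.
have [x [x_ge0 [i lt_i xi] hx]] := sweep_perron n0 (isT : (0 < size (B :: Bs))%N) hB.
set lam := rhoT _ in gt0 hx *.
pose y j := if (j < size Bs)%N then x j.+1 else lam *: x 0.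
have hx0 := hx 0 isT; rewrite sweep_cons0 in hx0.
apply: (@sweep_le_specrad _ _ (rcons Bs B) y) => //.
- by move=> j _; rewrite /y; case: ifP => // _; apply: nnegZ => //; exact: ltW.
- case: i lt_i xi => [|i] lt_i xi.
    by exists (size Bs); rewrite ?size_rcons // /y ltnn scaler_eq0 gt_eqF.
  by exists i; [rewrite size_rcons ltnW | rewrite /y (_ : (i < size Bs)%N)].
(* The last row is [lam] times row [0] of the old chain; any other row [i'] is the old row
   [i' + 1]. *)
- move=> i'; rewrite size_rcons ltnS leq_eqVlt => /orP[/eqP->|lt_i'].
    rewrite sweep_rcons ltnn sweep_full // (@eq_sweep _ _ _ y (fun j => x j.+1)).
      rewrite /y ltnn scale1r -scalemxAr -scalerDr [sweep _ _ _ _ + _]addrC hx0 subrr; exact: nneg0.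
    by move=> j lt_j; rewrite /y lt_j.
  rewrite sweep_rcons ltnNge (ltnW lt_i') /= scale1r (@eq_sweep _ _ _ y (fun j => x j.+1)).
    rewrite /y ltnn lt_i' -scalemxAr [sweep _ _ _ _ + _]addrC -sweep_consS hx // subrr.
    exact: nneg0.
  by move=> j lt_j; rewrite /y lt_j.
Qed.

Lemma rhoT_rot_ge k Bs : (k <= size Bs)%N -> nneg_seq Bs -> rhoT Bs <= rhoT (rot k Bs).
Proof.
elim: k => [|k IH] lt_k hB; first by rewrite rot0.
rewrite rotS //; apply: le_trans (IH (ltnW lt_k) hB) _; apply: rhoT_rot1.
by move=> B; rewrite mem_rot; exact: hB.
Qed.

(** [rotr k] is itself a left rotation and is undone by [rot k], so the one-sided inequality for
    rotations holds in both directions. *)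
Lemma rhoT_rotr k Bs : (k <= size Bs)%N -> nneg_seq Bs -> rhoT (rotr k Bs) = rhoT Bs.
Proof.
move=> le_k hB; apply/eqP; rewrite eq_le [X in _ && X]rhoT_rot_ge ?leq_subr // andbT.
have := @rhoT_rot_ge k (rotr k Bs); rewrite rotrK; apply; first by rewrite size_rotr.
by move=> B; rewrite mem_rotr; exact: hB.
Qed.

(** * Splitting and merging the last part *)

Lemma rhoT_merge_ge Bs C D : nneg_seq Bs -> nneg C -> nneg D ->
  1 <= rhoT (rcons Bs (C + D)) ->
  rhoT (rcons Bs (C + D)) <= rhoT (rcons (rcons Bs C) D).
Proof.
move=> hB hC hD ge1.
have hBs : nneg_seq (rcons Bs (C + D)) by apply/nneg_seq_rcons; split=> //; exact: nnegD.
have hBs' : nneg_seq (rcons (rcons Bs C) D).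
  by apply/nneg_seq_rcons; split=> //; exact/nneg_seq_rcons.
have s0 : (0 < size (rcons Bs (C + D)%R))%N by rewrite size_rcons.
have [x [x_ge0 [i lt_i xi] hx]] := sweep_perron n0 s0 hBs.
set lam := rhoT _ in ge1 hx *; set k := size Bs.
rewrite size_rcons ltnS -/k in lt_i.
have lam0 : 0 < lam by exact: lt_le_trans ge1.
(* The test chain keeps [x] and appends [x_k + c C x_k]. In the new last row [C x_k] has coefficient
   [lam], and [lam c = lam - 1] balances the excess over [1]; every row is then satisfied with
   surplus exactly [w]. The bound [lam >= 1] gives [c >= 0]. *)
pose c := 1 - lam^-1; have c_ge0 : 0 <= c by rewrite subr_ge0 invf_le1.
pose y j := if (j == k.+1)%N then x k + c *: (C *m x k) else x j.
have y_le j : (j <= k)%N -> y j = x j by move=> le_j; rewrite /y ltn_eqF.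
have yk : y k.+1 = x k + c *: (C *m x k) by rewrite /y eqxx.
have hk : sweep lam Bs x k + (C *m x k + D *m x k) = lam *: x k.
  by rewrite -hx ?size_rcons // sweep_rcons -/k ltnn scale1r mulmxDl.
have lamc : lam * c = lam - 1 by rewrite mulrBr mulr1 divff ?gt_eqF.
set w := D *m (c *: (C *m x k)); have w0 : nneg w.
  by apply: nnegM => //; apply: nnegZ => //; exact: nnegM.
apply: (@sweep_le_specrad _ _ _ y) => //.
- move=> j _; rewrite /y; case: ifP => // _.
  by apply: nnegD => //; apply: nnegZ => //; exact: nnegM.
- by exists i; [rewrite !size_rcons ltnS ltnW | rewrite y_le].
move=> j; rewrite !size_rcons -/k !ltnS => le_j.
have nlt_j : (k.+1 < j)%N = false by rewrite ltnNge le_j.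
rewrite !sweep_rcons !size_rcons -/k nlt_j scale1r yk mulmxDr -/w.
rewrite y_le // (@eq_sweep _ _ _ y x); last by move=> l lt_l; rewrite y_le // ltnW.
move: le_j; rewrite leq_eqVlt ltnS => /orP[/eqP->|le_j].
  rewrite ltnSn yk sweep_size.
  rewrite scalerDr -hk scalerA lamc.
  move: w w0 (sweep _ _ _ _) (C *m x k) (D *m x k) => u1 hu1 u2 u3 u4.
  by move=> l m; have := hu1 l m; rewrite !mxE; lra.
rewrite y_le // ltnNge le_j /= scale1r.
have := hx j; rewrite size_rcons ltnS -/k => /(_ le_j).
rewrite sweep_rcons -/k ltnNge le_j /= scale1r mulmxDl => <-.
move: w w0 (sweep _ _ _ _) (C *m x k) (D *m x k) => u1 hu1 u2 u3 u4.
by move=> l m; have := hu1 l m; rewrite !mxE; lra.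
Qed.

(** Subtracting the last two rows gives [lam (x_k - x_(k+1)) = (1 - lam) C x_k >= 0]. Dropping
    [x_(k+1)] and letting [D] act on [x_k] instead can thus only increase each remaining row. *)
Lemma rhoT_merge_le Bs C D : nneg_seq Bs -> nneg C -> nneg D ->
  rhoT (rcons (rcons Bs C) D) <= 1 ->
  rhoT (rcons (rcons Bs C) D) <= rhoT (rcons Bs (C + D)).
Proof.
move=> hB hC hD le1.
have hBs : nneg_seq (rcons Bs (C + D)) by apply/nneg_seq_rcons; split=> //; exact: nnegD.
have hBs' : nneg_seq (rcons (rcons Bs C) D).
  by apply/nneg_seq_rcons; split=> //; exact/nneg_seq_rcons.
have s0 : (0 < size (rcons Bs (C + D)%R))%N by rewrite size_rcons.
have s0' : (0 < size (rcons (rcons Bs C) D))%N by rewrite size_rcons.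
have [x [x_ge0 [i lt_i xi] hx]] := sweep_perron n0 s0' hBs'.
set lam := rhoT _ in le1 hx *; set k := size Bs.
have [lam_le0|lam0] := leP lam 0; first exact: le_trans lam_le0 (rhoT_ge0 s0 hBs).
rewrite !size_rcons !ltnS -/k in lt_i.
have hxk := hx k; have hxk1 := hx k.+1.
rewrite !size_rcons -/k !ltnS leqnSn in hxk; rewrite !size_rcons -/k !ltnS leqnn in hxk1.
move: (hxk isT) (hxk1 isT) => {hxk hxk1}.
rewrite !sweep_rcons !size_rcons -/k ltnSn !ltnn ltnNge leqnSn /= !scale1r.
rewrite sweep_size.
move=> hxk hxk1.
have dx : nneg (x k - x k.+1).
  apply: (nneg_scaled lam0); rewrite scalerBr -hxk -hxk1.
  have h : nneg ((1 - lam) *: (C *m x k)) by apply: nnegZ; [rewrite subr_ge0 | exact: nnegM].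
  move: h; move: (sweep _ _ _ _) (C *m x k) (D *m x k.+1) => u2 u3 u4 h.
  by move=> a b; have := h a b; rewrite !mxE; lra.
apply: (@sweep_le_specrad _ _ _ x) => //.
(* If the dropped block is nonzero, then so is [x_k], which dominates it. *)
- move: lt_i; rewrite leq_eqVlt ltnS size_rcons => /orP[/eqP ik|]; last by exists i.
  exists k => //; apply: contra_neq xi => xk0; rewrite ik.
  exact: nneg_sub_eq0 dx xk0.
- move=> j; rewrite size_rcons ltnS -/k => le_j.
  have := hx j; rewrite !size_rcons -/k !ltnS => /(_ (leqW le_j)) <-.
  have [nlt_j nlt_j1] : (k < j)%N = false /\ (k.+1 < j)%N = false.
    by rewrite !ltnNge le_j leqW.
  rewrite !sweep_rcons !size_rcons -/k nlt_j nlt_j1 !scale1r mulmxDl.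
  have h : nneg (D *m (x k - x k.+1)) by exact: nnegM.
  move: h; rewrite mulmxBr.
  move: (sweep _ _ _ _) (C *m x k) (D *m x k) (D *m x k.+1) => u2 u3 u4 u5 h.
  by move=> a b; have := h a b; rewrite !mxE; lra.
Qed.

(** * Comparison with the spectral radius of the sum *)

Lemma rhoT_ge_specrad_sum Bs : (0 < size Bs)%N -> nneg_seq Bs ->
  1 <= specrad (\sum_(B <- Bs) B) -> specrad (\sum_(B <- Bs) B) <= rhoT Bs.
Proof.
move=> s0 hB ge1; have [[x [x_ge0 x0 hx]] _] := specrad_perron n0 (nneg_sum_seq hB).
(* The constant chain is the test vector: row coefficients are [1] or the Perron root, which is at
   least [1]. *)
apply: (@sweep_le_specrad _ _ _ (fun=> x)) => //; first by exists 0%N.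
move=> i _; rewrite -hx sum_mulmx /sweep -sumrB; apply: nneg_sum => j _.
rewrite -[X in _ - X]scale1r -scalerBl; apply: nnegZ.
  by rewrite subr_ge0; case: ifP.
by apply: nnegM => //; exact: nneg_seq_nth.
Qed.

(** For [lam <= 1] the first block dominates the chain, so row [0] yields
    [lam x_0 <= (\sum B) x_0]. *)
Lemma rhoT_le_specrad_sum Bs : (0 < size Bs)%N -> nneg_seq Bs ->
  rhoT Bs <= 1 -> rhoT Bs <= specrad (\sum_(B <- Bs) B).
Proof.
move=> s0 hB le1; have hS := nneg_sum_seq hB.
have [lam_le0|lam0] := leP (rhoT Bs) 0; first exact: le_trans lam_le0 (specrad_ge0 n0 hS).
have [x [x_ge0 [i lt_i xi] hx]] := sweep_perron n0 s0 hB.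
set lam := rhoT _ in le1 hx lam0 *.
have dx j : (j < size Bs)%N -> nneg (x 0 - x j).
  move=> lt_j; apply: (nneg_scaled lam0); rewrite scalerBr -!hx //.
  by rewrite -[X in X - _]scale1r; exact: sweep_diff.
apply: (specrad_perron n0 hS).2; exists (x 0); split=> //.
  by apply: contra_neq xi => /(nneg_sub_eq0 (x_ge0 i) (dx i lt_i)).
rewrite -hx // sum_mulmx sweep0E -sumrB big_seq; apply: nneg_sum => j.
rewrite mem_index_iota => /andP[_ lt_j].
by rewrite -mulmxBr; apply: nnegM; [exact: nneg_seq_nth | exact: dx].
Qed.

(** For [lam >= 1] every block is at most [lam x_0], so row [0] makes [lam x_0] a test vector for
    the number [1]. *)
Lemma specrad_sum_ge1 Bs : (0 < size Bs)%N -> nneg_seq Bs ->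
  1 <= rhoT Bs -> 1 <= specrad (\sum_(B <- Bs) B).
Proof.
move=> s0 hB ge1; have hS := nneg_sum_seq hB.
have [x [x_ge0 [i lt_i xi] hx]] := sweep_perron n0 s0 hB.
set lam := rhoT _ in ge1 hx; have lam0 : 0 < lam by exact: lt_le_trans ge1.
have dx j : (j < size Bs)%N -> nneg (lam *: x 0 - x j).
  move=> lt_j; apply: (nneg_scaled lam0); rewrite scalerBr -!hx //.
  exact: sweep_diff.
apply: (specrad_perron n0 hS).2; exists (lam *: x 0); split.
- by apply: nnegZ => //; exact: ltW.
- by apply: contra_neq xi => /(nneg_sub_eq0 (x_ge0 i) (dx i lt_i)).
rewrite scale1r -[X in _ - X]hx // sum_mulmx sweep0E -sumrB big_seq; apply: nneg_sum => j.
rewrite mem_index_iota => /andP[_ lt_j].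
by rewrite -mulmxBr; apply: nnegM; [exact: nneg_seq_nth | exact: dx].
Qed.

(** The weighted chain [t^j x_j] is the test vector. Its row inequalities reduce to [t^i <= t^(j+1)]
    for [j < i] and [t^(d+i) <= t^(j+1)] for [i <= j < d], where [d] is the number of parts. *)
Lemma rhoT_scale Bs t : (0 < size Bs)%N -> nneg_seq Bs -> 0 < t -> t <= 1 ->
  0 < rhoT Bs -> t ^+ size Bs * rhoT Bs <= rhoT [seq t *: B | B <- Bs].
Proof.
move=> s0 hB t0 t1 lam0.
have [x [x_ge0 [i lt_i xi] hx]] := sweep_perron n0 s0 hB.
set lam := rhoT Bs in lam0 hx *.
have t_ge0 k : 0 <= t ^+ k by rewrite exprn_ge0 // ltW.
apply: (@sweep_le_specrad _ _ _ (fun j => t ^+ j *: x j)) => //.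
- by move=> A /mapP[B /hB hB' ->]; apply: nnegZ => //; exact: ltW.
- by move=> j _; exact: nnegZ.
- by exists i; rewrite ?size_map // scaler_eq0 negb_or xi expf_neq0 // gt_eqF.
rewrite size_map => {lt_i xi} {}i lt_i.
have -> : (t ^+ size Bs * lam) *: (t ^+ i *: x i) = \sum_(0 <= j < size Bs)
    (t ^+ size Bs * t ^+ i * (if (j < i)%N then lam else 1)) *: (nth 0 Bs j *m x j).
  rewrite scalerA mulrAC -scalerA -hx // scaler_sumr.
  by apply: eq_bigr => j _; rewrite scalerA.
rewrite /sweep size_map -sumrB big_seq; apply: nneg_sum => j.
rewrite mem_index_iota => /andP[_ lt_j].
rewrite (nth_map 0) // -scalemxAl -scalemxAr !scalerA -scalerBl; apply: nnegZ; last first.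
  by apply: nnegM => //; exact: nneg_seq_nth.
have t_le k l : (k <= l)%N -> t ^+ l <= t ^+ k.
  by move=> le_kl; rewrite ler_wiXn2l // ltW.
rewrite subr_ge0; case: ltnP => [lt_ji|le_ij].
  rewrite [leRHS](_ : _ = t ^+ size Bs * lam * t ^+ j.+1); last by rewrite exprS; ring.
  by rewrite mulrAC; apply: ler_wpM2l; [rewrite mulr_ge0 // ltW | exact: t_le].
rewrite mulr1 mul1r -exprS -exprD; apply: t_le; exact: leq_trans lt_j (leq_addr _ _).
Qed.

Lemma bernoulli (e : R) k : 0 <= e <= 1 -> 1 - k%:R * e <= (1 - e) ^+ k.
Proof.
move=> /andP[e0 e1]; elim: k => [|k IH]; first by rewrite mul0r subr0 expr0.
rewrite exprS -natr1; have : 0 <= k%:R * (e * e) by rewrite !mulr_ge0.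
by have := ler_wpM2l (_ : 0 <= 1 - e) IH; rewrite subr_ge0 => /(_ e1); lra.
Qed.

(* Shrinking [Bs] by [t < 1] with [t ^ size Bs * rho(T) >= 1] keeps the hypothesis of
   [specrad_sum_ge1], and scaling back by [1 / t] makes its conclusion strict. *)
Lemma specrad_sum_gt1 Bs : (0 < size Bs)%N -> nneg_seq Bs ->
  1 < rhoT Bs -> 1 < specrad (\sum_(B <- Bs) B).
Proof.
move=> s0 hB; set lam := rhoT Bs => gt1.
have lam0 : 0 < lam by exact: lt_trans gt1.
have d0 : 0 < (size Bs)%:R :> R by rewrite ltr0n.
(* Chosen so that [1 - d e = lam^-1] with [d = size Bs]; Bernoulli's inequality then gives
   [t^d >= lam^-1]. *)
pose e := (1 - lam^-1) / (size Bs)%:R; pose t := 1 - e.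
have li0 : 0 < lam^-1 by rewrite invr_gt0.
have e0 : 0 < e by rewrite divr_gt0 // subr_gt0 invf_lt1.
have e1 : e < 1.
  rewrite ltr_pdivrMr // mul1r (@lt_le_trans _ _ 1) ?ler1n //; lra.
have t0 : 0 < t by rewrite subr_gt0.
have t1 : t < 1 by rewrite /t; lra.
have td : 1 <= t ^+ size Bs * lam.
  rewrite -ler_pdivrMr // div1r.
  apply: le_trans (bernoulli (size Bs) _); last by rewrite !ltW.
  by rewrite /e mulrC divfK ?gt_eqF // opprB addrC subrK.
have hS := nneg_sum_seq hB.
pose tBs := [seq t *: B | B <- Bs].
have htB : nneg_seq tBs.
  by move=> A /mapP[B /hB hB' ->]; apply: nnegZ => //; exact: ltW.
have st : (0 < size tBs)%N by rewrite size_map.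
have tsum : \sum_(B <- tBs) B = t *: \sum_(B <- Bs) B by rewrite big_map scaler_sumr.
have ge1 : 1 <= specrad (t *: \sum_(B <- Bs) B).
  rewrite -tsum; apply: specrad_sum_ge1 => //.
  by apply: le_trans td _; apply: rhoT_scale => //; exact: ltW.
have htS : nneg (t *: \sum_(B <- Bs) B) by rewrite -tsum; exact: nneg_sum_seq.
have [[x [x_ge0 x0 hx]] _] := specrad_perron n0 htS.
apply: (@lt_le_trans _ _ t^-1); first by rewrite invf_gt1.
apply: (specrad_perron n0 hS).2; exists x; split=> //.
apply: (nneg_scaled t0); rewrite scalerBr scalemxAl hx scalerA divff ?gt_eqF //.
by rewrite -scalerBl; apply: nnegZ => //; rewrite subr_ge0.
Qed.

End Comparison.

(* Disjoint supports: each entry of [BJ] comes from at most one part. *)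
Lemma nneg_splitting (R : realType) n (BJ : 'M[R]_n) (Bs : seq 'M[R]_n) :
  nneg BJ -> is_splitting BJ Bs -> nneg_seq Bs.
Proof.
move=> hBJ [_ _ hsum hdisj] B hB i j.
have [p lt_p ->] : exists2 p, (p < size Bs)%N & B = nth 0 Bs p.
  by exists (index B Bs); rewrite ?index_mem // nth_index.
have [->//|Bij] := eqVneq (nth 0 Bs p i j) 0.
have := hBJ i j; rewrite -hsum summxE (big_nth 0) big_mkord (bigD1 (Ordinal lt_p)) //=.
rewrite big1 ?addr0 // => q neq_qp.
have neq_pq : p != q by apply: contra_neq neq_qp => pq; exact/val_inj.
have := congr1 (fun M : 'M[R]_n => M i j) (hdisj p q lt_p (ltn_ord q) neq_pq).
by rewrite !mxE => /eqP; rewrite mulf_eq0 (negPf Bij) => /eqP.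
Qed.

Lemma rcons_take_nth (T : Type) (x0 : T) (s : seq T) k :
  size s = k.+1 -> s = rcons (take k s) (nth x0 s k).
Proof. by move=> hs; rewrite -take_nth ?hs // -hs take_size. Qed.

Theorem theorem3p1 (R : realType) (n d : nat) (BJ : 'M[R]_n)
    (Bs Bs' : seq 'M[R]_n) (r s : nat) :
  (forall i j, 0 <= BJ i j) ->
  0 < specrad BJ ->
  (1 <= d)%N ->
  is_splitting BJ Bs -> size Bs = d ->
  is_splitting BJ Bs' -> size Bs' = d.+1 ->
  (r <= d - 1)%N -> (s <= d)%N ->
  (forall p, (p < d - 1)%N ->
     nth 0 (cshift s Bs') p = nth 0 (cshift r Bs) p) ->
  is_splitting (nth 0 (cshift r Bs) (d - 1))
     [:: nth 0 (cshift s Bs') (d - 1); nth 0 (cshift s Bs') d] ->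
  [/\ specrad BJ < 1 ->
        specrad (iter_mx Bs') <= specrad (iter_mx Bs)
        /\ specrad (iter_mx Bs) <= specrad BJ,
      specrad BJ = 1 ->
        specrad (iter_mx Bs') = 1 /\ specrad (iter_mx Bs) = 1 &
      1 < specrad BJ ->
        specrad (iter_mx Bs') >= specrad (iter_mx Bs)
        /\ specrad (iter_mx Bs) >= specrad BJ].
Proof.
move=> hBJ rho0 d0 hBs sBs hBs' sBs' le_r le_s heq [_ _ hCD _].
have n0 : (0 < n)%N.
  by have [n_eq0|//] := posnP n; subst n; rewrite specrad0 ltxx in rho0.
have nB := nneg_splitting hBJ hBs; have nB' := nneg_splitting hBJ hBs'.
have [_ _ sumB _] := hBs; have [_ _ sumB' _] := hBs'.
have s0 : (0 < size Bs)%N by rewrite sBs.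
have s0' : (0 < size Bs')%N by rewrite sBs'.
case: d d0 sBs sBs' le_r le_s heq hCD => // k _ sBs sBs' le_r le_s.
rewrite subn1 /= in le_r * => heq; rewrite big_cons big_seq1 => hCD.
set X := cshift r Bs in heq hCD; set Y := cshift s Bs' in heq hCD.
have sX : size X = k.+1 by rewrite size_rotr.
have sY : size Y = k.+2 by rewrite size_rotr.
have rX : specrad (iter_mx X) = specrad (iter_mx Bs).
  by apply: rhoT_rotr => //; rewrite sBs leqW.
have rY : specrad (iter_mx Y) = specrad (iter_mx Bs').
  by apply: rhoT_rotr => //; rewrite sBs' leqW.
have nX : nneg_seq X by move=> B; rewrite mem_rotr; exact: nB.
have nY : nneg_seq Y by move=> B; rewrite mem_rotr; exact: nB'.
pose C := nth 0 Y k; pose D := nth 0 Y k.+1; pose P := take k X.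
(* After rotation both lists begin with [P]; they differ only in the last part [C + D], which is
   split into [C] and [D]. *)
have XE : X = rcons P (C + D) by rewrite (rcons_take_nth 0 sX) hCD.
have YE : Y = rcons (rcons P C) D.
  rewrite (rcons_take_nth 0 sY); congr rcons.
  have sY' : size (take k.+1 Y) = k.+1 by rewrite size_take sY ltnSn.
  rewrite (rcons_take_nth 0 sY') nth_take // take_takel //; congr rcons.
  have tX : size (take k X) = k by rewrite size_takel // sX.
  have tY : size (take k Y) = k by rewrite size_takel // sY leqW.
  apply: (@eq_from_nth _ 0); first by rewrite tX tY.
  by move=> i; rewrite tY => lt_i; rewrite !nth_take // heq.
have nP : nneg_seq P by move=> B /mem_take; exact: nX.
have nC : nneg C by exact: nneg_seq_nth.
have nD : nneg D by exact: nneg_seq_nth.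
have up : 1 <= specrad (iter_mx Bs) -> specrad (iter_mx Bs) <= specrad (iter_mx Bs').
  by rewrite -rX -rY XE YE; exact: rhoT_merge_ge.
have down : specrad (iter_mx Bs') <= 1 -> specrad (iter_mx Bs') <= specrad (iter_mx Bs).
  by rewrite -rX -rY XE YE; exact: rhoT_merge_le.
have := rhoT_ge_specrad_sum n0 s0 nB; have := rhoT_ge_specrad_sum n0 s0' nB'.
have := rhoT_le_specrad_sum n0 s0 nB.
have := specrad_sum_ge1 n0 s0 nB; have := specrad_sum_ge1 n0 s0' nB'.
have := specrad_sum_gt1 n0 s0 nB; have := specrad_sum_gt1 n0 s0' nB'.
rewrite sumB sumB' => gt1' gt1 ge1' ge1 le_BJ ge_BJ' ge_BJ.
split=> [lt_1|eq_1|gt_1].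
(* If either iteration matrix had spectral radius at least [1], so would the sum; this supplies the
   bound that [down] and [le_BJ] require. *)
- have lt_T : specrad (iter_mx Bs) < 1.
    by rewrite ltNge; apply/negP => /ge1; rewrite leNgt lt_1.
  have lt_T' : specrad (iter_mx Bs') < 1.
    by rewrite ltNge; apply/negP => /ge1'; rewrite leNgt lt_1.
  by split; [apply: down | apply: le_BJ]; exact: ltW.
(* The lower bounds come from the constant chain, and the upper bounds from the strict implication:
   a radius above [1] would force [1 < 1]. *)
- rewrite eq_1 lexx ltxx in gt1 gt1' ge_BJ ge_BJ'.
  split; apply/eqP; rewrite eq_le.
    by rewrite ge_BJ' // andbT leNgt; apply/negP => /gt1'.
  by rewrite ge_BJ // andbT leNgt; apply/negP => /gt1.
- have ge_T := ge_BJ (ltW gt_1); split=> //.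
  by apply: up; exact: le_trans (ltW gt_1) ge_T.
Qed.
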